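(* Let $X=\sum_{\alpha\in\mathcal X}I_\alpha$, $\mu=\mathbb E X$ and $\Lambda$ be as defined in the context. Suppose that $\mathbf p=(p,\dots,p)\in[0,1]^N$ and $\min_{\alpha\in\mathcal X}|Q(\alpha)|\ge k$, where $k\ge1$ is an integer. For all $\varepsilon,\tau\in(0,1]$ satisfying $\tau\ge\mathbf 1_{\{k>1\}}6\varepsilon$ and $(\varepsilon\mu)^2\ge4\tau^{-2}\Lambda$ we have, with $c=1/2$, $$\mathbb P(X\le(1-\varepsilon)\mathbb E X)\ \ge\ c\;\mathbb P\bigl(|\Gamma_{\mathbf p}|\le(1-(1+\tau)\varepsilon/k)\,\mathbb E|\Gamma_{\mathbf p}|\bigr).$$
   Context: Setting: $\Gamma$ is a finite set with $|\Gamma|=N$, $\mathbf p=(p_i)_{i\in\Gamma}\in[0,1]^N$, and $\Gamma_{\mathbf p}\subseteq\Gamma$ is the random subset in which each $i\in\Gamma$ is included independently with probability $p_i$. $(Q(\alpha))_{\alpha\in\mathcal X}$ is a family of subsets of $\Gamma$ indexed by a finite nonempty set $\mathcal X$, $I_\alpha=\mathbf 1_{\{Q(\alpha)\subseteq\Gamma_{\mathbf p}\}}$, and $X=\sum_{\alpha\in\mathcal X}I_\alpha$. Write $\alpha\sim\beta$ if $\alpha\ne\beta$ and $Q(\alpha)\cap Q(\beta)\neq\emptyset$. Put $\mu=\mathbb E X$ and $\Lambda=\mu+\sum_{(\alpha,\beta)\in\mathcal X\times\mathcal X:\,\alpha\sim\beta}\mathbb E I_\alpha I_\beta$. $\mathbf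 1_{\{A\}}$ equals $1$ if $A$ holds and $0$ otherwise. *)

(* Defs.v *)
From mathcomp Require Import all_boot all_order all_algebra.
From mathcomp Require Import reals.
Set Implicit Arguments.
Unset Strict Implicit.
Unset Printing Implicit Defensive.
Import Order.TTheory GRing.Theory Num.Theory.
Local Open Scope ring_scope.

Section RandomSubset.
Variables (R : realType) (G : finType).

(* The law of the random subset of G containing each i independently with
   probability p i: the mass of an outcome S : {set G}. Events and random
   variables are predicates and functions on the sample space {set G}. *)
Definition rset_mass (p : G -> R) (S : {set G}) : R :=
  \prod_(i : G) (if i \in S then p i else 1 - p i).

Definition rset_Pr (p : G -> R) (A : pred {set G}) : R :=
  \sum_(S : {set G} | A S) rset_mass p S.

Definition rset_E (p : G -> R) (Y : {set G} -> R) : R :=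
  \sum_(S : {set G}) rset_mass p S * Y S.

Definition rset_card (S : {set G}) : R := #|S|%:R.

Variables (T : finType) (Q : T -> {set G}).

Definition indic (a : T) (S : {set G}) : R := (Q a \subset S)%:R.

Definition count_sub (S : {set G}) : R := \sum_(a : T) indic a S.

Definition dep (a b : T) : bool := (a != b) && (Q a :&: Q b != set0).

Definition mean_sub (p : G -> R) : R := rset_E p count_sub.

(* The sum ranges over ordered pairs. *)
Definition Lambda (p : G -> R) : R :=
  mean_sub p
  + \sum_(ab : T * T | dep ab.1 ab.2)
      rset_E p (fun S => indic ab.1 S * indic ab.2 S).

End RandomSubset.

Arguments rset_card {R G} S.
Arguments indic {R G T} Q a S.
Arguments count_sub {R G T} Q S.
Arguments mean_sub {R G T} Q p.
Arguments Lambda {R G T} Q p.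

(* Main.v *)
(** Condition on the size [m] of the random set, which then is a uniform
    [m]-subset of the [N]-element ground set. A fixed set of size [q] is contained
    in it with probability [m ^_ q / N ^_ q <= (m / N) ^ q], and containments of
    disjoint sets are negatively correlated. Hence, for every [m] at most
    [(1 - (1 + tau) eps / k) N p], the conditional variance of [X] is at most
    [Lambda <= s ^ 2 / 4], where [s = tau eps mu], and its conditional mean is at
    most [(1 - (1 + tau) eps / k) ^ k mu <= (1 - eps) mu - 2 s / 3]. Cantelli's
    inequality shows that [X <= (1 - eps) mu] has conditional probability at least
    [1/2]; summing over [m] gives the result. *)

Require Import Defs.
From mathcomp Require Import all_boot all_order all_algebra.
From mathcomp Require Import reals.
From mathcomp Require Import zify ring lra.
Import Order.TTheory GRing.Theory Num.Theory.
Local Open Scope ring_scope.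

(** * Moments in the independent model *)

Lemma rset_E_subset {R : realType} {G : finType} (p : G -> R) (W : {set G}) :
  rset_E p (fun S => (W \subset S)%:R) = \prod_(i in W) p i.
Proof.
(* Expanding this product gives one term per set [S]; the weight 0 for omitting a point of [W] kills
   exactly the [S] that do not contain [W]. *)
transitivity (\prod_i (p i + (if i \in W then 0 else 1 - p i))).
  rewrite bigA_distr; apply: eq_bigr => S _; rewrite /rset_mass.
  have [sWS|/subsetPn[i iW iNS]] := boolP (W \subset S).
    rewrite mulr1; apply: eq_bigr => i _; case: ifP => // iNS.
    by case: ifP => // iW; rewrite (subsetP sWS i iW) in iNS.
  by rewrite mulr0 (bigD1 i) //= (negbTE iNS) iW mul0r.
rewrite [RHS]big_mkcond; apply: eq_bigr => i _.
by case: ifP => _; [rewrite addr0 | rewrite subrKC].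
Qed.

Lemma rset_E_sum {R : realType} {G T : finType} (p : G -> R)
    (F : T -> {set G} -> R) :
  rset_E p (fun S => \sum_a F a S) = \sum_a rset_E p (F a).
Proof.
rewrite /rset_E exchange_big /=; apply: eq_bigr => S _.
by rewrite mulr_sumr.
Qed.

Lemma eq_rset_E {R : realType} {G : finType} (p : G -> R)
    (Y Z : {set G} -> R) : Y =1 Z -> rset_E p Y = rset_E p Z.
Proof. by move=> YZ; apply: eq_bigr => S _; rewrite YZ. Qed.

Lemma rset_mass_const {R : realType} {G : finType} (p : R) (S : {set G}) :
  rset_mass (fun=> p) S = p ^+ #|S| * (1 - p) ^+ (#|G| - #|S|).
Proof.
rewrite /rset_mass (bigID (mem S)) /=; congr (_ * _).
  by rewrite (eq_bigr (fun=> p)) => [|i ->//]; rewrite prodr_const.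
rewrite (eq_bigr (fun=> 1 - p)) => [|i /negbTE->//].
rewrite -[in RHS](setCK S) -cardsCs -prodr_const; apply: eq_bigl => i.
by rewrite inE.
Qed.

Lemma rset_E_card {R : realType} {G : finType} (p : R) :
  rset_E (fun _ : G => p) rset_card = #|G|%:R * p.
Proof.
rewrite (@eq_rset_E _ _ _ _ (fun S => \sum_i ([set i] \subset S)%:R)); last first.
  move=> S; rewrite /rset_card -sum1_card natr_sum big_mkcond.
  by apply: eq_bigr => i _; rewrite sub1set; case: (i \in S).
rewrite rset_E_sum (eq_bigr (fun=> p)) => [|i _].
  by rewrite sumr_const mulr_natl.
by rewrite rset_E_subset big_set1.
Qed.

Lemma mean_sub_const {R : realType} {G T : finType} (Q : T -> {set G}) (p : R) :
  mean_sub Q (fun=> p) = \sum_a p ^+ #|Q a|.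
Proof.
rewrite /mean_sub /count_sub rset_E_sum; apply: eq_bigr => a _.
by rewrite rset_E_subset prodr_const.
Qed.

Lemma indicM {R : realType} {G T : finType} (Q : T -> {set G}) a b S :
  indic Q a S * indic Q b S = (Q a :|: Q b \subset S)%:R :> R.
Proof. by rewrite /indic subUset -natrM mulnb. Qed.

Lemma Lambda_const {R : realType} {G T : finType} (Q : T -> {set G}) (p : R) :
  Lambda Q (fun=> p) = \sum_a p ^+ #|Q a|
    + \sum_a \sum_(b | dep Q a b) p ^+ #|Q a :|: Q b|.
Proof.
rewrite /Lambda mean_sub_const [in RHS]pair_big_dep /=; congr (_ + _).
apply: eq_bigr => ab _.
rewrite (eq_rset_E _ _ _ (indicM Q ab.1 ab.2)).
by rewrite rset_E_subset prodr_const.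
Qed.

(** * Counting supersets, falling factorials and a power estimate *)

Lemma card_supersets {G : finType} (W : {set G}) (m : nat) : (m <= #|G|)%N ->
  #|[set S : {set G} | (#|S| == m) && (W \subset S)]| = 'C(#|G| - #|W|, #|G| - m).
Proof.
(* Complementation turns the sets into subsets of [~: W] of size [#|G| - m]. *)
move=> mN; have <- : #|~: W| = (#|G| - #|W|)%N by rewrite cardsCs setCK.
rewrite -cards_draws -[LHS](card_imset _ (@setC_inj G)); apply: eq_card => S.
rewrite -[S in LHS]setCK (mem_imset _ _ (@setC_inj G)) !inE.
rewrite -[in RHS](setCK S) setCS setCK andbC; congr (_ && _).
have := max_card (mem S); have := cardsC S => SC SN.
by apply/eqP/eqP; lia.
Qed.

(** Choosing the [N - m] omitted points, rather than [m - q] further ones, keeps the identity true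
    for [q > m], where both sides vanish. *)
Lemma bin_ffact_ratio (N m q : nat) : (m <= N)%N -> (q <= N)%N ->
  ('C(N - q, N - m) * N ^_ q = 'C(N, m) * m ^_ q)%N.
Proof.
move=> mN; elim: q => [|q IH] qN; first by rewrite !ffactn0 subn0 bin_sub.
rewrite !ffactnSr.
have -> : ('C(N - q.+1, N - m) * (N ^_ q * (N - q))
  = N ^_ q * ((N - q) * 'C((N - q).-1, N - m)))%N by rewrite subnS; lia.
rewrite mul_bin_down.
have -> : (N - q - (N - m) = m - q)%N by lia.
by rewrite mulnA [RHS]mulnA -IH ?(ltnW qN) //; lia.
Qed.

Lemma ffact_expn_ratio (N m q : nat) : (m <= N)%N ->
  (m ^_ q * N ^ q <= m ^ q * N ^_ q)%N.
Proof.
move=> mN; elim: q => // q IH; rewrite !ffactnSr !expnSr.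
rewrite mulnACA [leqRHS]mulnACA leq_mul //.
nia.
Qed.

(** Factor by factor, [(m - j) / (N - j)] decreases in [j], so shifting [j] from [b] to [a + b]
    lowers it. *)
Lemma ffact_ratio_neg_corr (N m a b : nat) : (m <= N)%N ->
  (m ^_ (a + b) * (N ^_ a * N ^_ b) <= m ^_ a * m ^_ b * N ^_ (a + b))%N.
Proof.
move=> mN; elim: b => [|b IH]; first by rewrite addn0 !ffactn0 !muln1.
rewrite addnS !ffactnSr.
have step : ((m - (a + b)) * (N - b) <= (m - b) * (N - (a + b)))%N by nia.
by have := leq_mul IH step; lia.
Qed.

(** Second-order Bonferroni bound; the inductive step loses exactly [k (k - 1) x ^ 3 / 2]. *)
Lemma expr_onem_le {R : realFieldType} (x : R) (k : nat) : 0 <= x <= 1 ->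
  (1 - x) ^+ k <= 1 - k%:R * x + k%:R * (k%:R - 1) / 2 * x ^+ 2.
Proof.
move=> /andP[x0 x1]; elim: k => [|k IH]; first by rewrite expr0; lra.
rewrite exprSr; apply: (le_trans (ler_wpM2r _ IH)); first by lra.
have kk : 0 <= k%:R * (k%:R - 1) * x ^+ 3 :> R.
  apply: mulr_ge0; last exact: exprn_ge0.
  by case: k {IH} => [|k]; rewrite ?mul0r // -natr1 addrK mulr_ge0 // ?natr1.
rewrite -natr1 -subr_ge0.
set d := (X in 0 <= X).
have -> : d = k%:R * (k%:R - 1) * x ^+ 3 / 2 by rewrite /d; field.
by rewrite divr_ge0.
Qed.
(** For [m, q <= N], the probability that a uniform [m]-subset of an [N]-set contains a fixed
    [q]-subset. *)
Definition ffact_ratio {R : realFieldType} (N m q : nat) : R :=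
  (m ^_ q)%:R / (N ^_ q)%:R.

Lemma ffact_ratio_ge0 {R : realFieldType} (N m q : nat) :
  0 <= ffact_ratio N m q :> R.
Proof. by rewrite divr_ge0. Qed.

Lemma ffact_ratio_le {R : realFieldType} (N m q : nat) : (m <= N)%N ->
  (q <= N)%N -> (0 < N)%N -> ffact_ratio N m q <= (m%:R / N%:R) ^+ q :> R.
Proof.
move=> mN qN N0; rewrite expr_div_n ler_pdivrMr ?ltr0n ?ffact_gt0 //.
rewrite mulrAC ler_pdivlMr ?exprn_gt0 ?ltr0n //.
by rewrite -!natrX -!natrM ler_nat ffact_expn_ratio.
Qed.

Lemma ffact_ratioD {R : realFieldType} (N m a b : nat) : (m <= N)%N ->
  (a + b <= N)%N ->
  ffact_ratio N m (a + b) <= ffact_ratio N m a * ffact_ratio N m b :> R.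
Proof.
move=> mN abN; rewrite mulf_div ler_pdivrMr ?ltr0n ?ffact_gt0 //.
rewrite mulrAC ler_pdivlMr; last by rewrite -natrM ltr0n muln_gt0 !ffact_gt0; lia.
by rewrite -!natrM ler_nat ffact_ratio_neg_corr.
Qed.

(** * Moments and lower tail of the count on a slice of sets of equal size *)

Lemma sum_slice_subset {R : realType} {G : finType} (W : {set G}) (m : nat) :
  (m <= #|G|)%N -> \sum_(S : {set G} | #|S| == m) (W \subset S)%:R
    = 'C(#|G|, m)%:R * ffact_ratio #|G| m #|W| :> R.
Proof.
move=> mN; have WN := max_card (mem W).
rewrite /ffact_ratio mulrA -natrM -bin_ffact_ratio // natrM mulfK; last first.
  by rewrite pnatr_eq0 -lt0n ffact_gt0.
rewrite -card_supersets // -sum1_card natr_sum big_mkcond [RHS]big_mkcond /=.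
by apply: eq_bigr => S _; rewrite inE; case: (_ == _); case: (_ \subset _).
Qed.

Lemma sum_slice_count {R : realType} {G T : finType} (Q : T -> {set G})
    (m : nat) : (m <= #|G|)%N ->
  \sum_(S : {set G} | #|S| == m) count_sub Q S
    = 'C(#|G|, m)%:R * \sum_a ffact_ratio #|G| m #|Q a| :> R.
Proof.
move=> mN; rewrite exchange_big mulr_sumr; apply: eq_bigr => a _.
exact: sum_slice_subset.
Qed.

Lemma sum_slice_count_sqr {R : realType} {G T : finType} (Q : T -> {set G})
    (m : nat) : (m <= #|G|)%N ->
  \sum_(S : {set G} | #|S| == m) count_sub Q S ^+ 2
    = 'C(#|G|, m)%:R * \sum_a \sum_b ffact_ratio #|G| m #|Q a :|: Q b| :> R.
Proof.
move=> mN.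
rewrite (eq_bigr (fun S : {set G} =>
  \sum_a \sum_b (Q a :|: Q b \subset S)%:R : R)); last first.
  move=> S _; rewrite expr2 mulr_suml; apply: eq_bigr => a _.
  by rewrite mulr_sumr; apply: eq_bigr => b _; rewrite indicM.
rewrite exchange_big mulr_sumr; apply: eq_bigr => a _.
rewrite exchange_big mulr_sumr; apply: eq_bigr => b _.
exact: sum_slice_subset.
Qed.

(* In the uniform model disjoint sets are negatively correlated, so only the
   pairs entering Lambda contribute to the variance. *)
Lemma sum_ffact_ratio_setU_le {R : realType} {G T : finType}
    (Q : T -> {set G}) (p : R) (m : nat) :
  (m <= #|G|)%N -> (0 < #|G|)%N -> m%:R / #|G|%:R <= p ->
  \sum_a \sum_b ffact_ratio #|G| m #|Q a :|: Q b|
    <= (\sum_a ffact_ratio #|G| m #|Q a|) ^+ 2 + Lambda Q (fun=> p).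
Proof.
move=> mN N0 mp.
have p0 : 0 <= p by apply: le_trans mp; rewrite divr_ge0.
have ratio_le (W : {set G}) : ffact_ratio #|G| m #|W| <= p ^+ #|W|.
  apply: le_trans (ffact_ratio_le _ _ _ mN (max_card _) N0) _.
  by rewrite lerXn2r // nnegrE divr_ge0.
rewrite Lambda_const expr2 mulr_suml -!big_split /=.
(* The diagonal term [b = a] is split off everywhere; it is absorbed by the mean contained in
   [Lambda]. *)
apply: ler_sum => a _; rewrite mulr_sumr (bigD1 a) //=.
rewrite [X in _ <= X + _](bigD1 a) //= setUid.
rewrite [X in _ <= _ + (_ + X)]big_mkcond [X in _ <= _ + (_ + X)](bigD1 a) //=.
rewrite {1}/dep eqxx /= add0r.
have -> (x y z t : R) : x + y + (z + t) = (x + z) + (y + t) by ring.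
apply: lerD.
  by apply: ler_wpDl; [rewrite mulr_ge0 ?ffact_ratio_ge0 | exact: ratio_le].
rewrite -big_split /=; apply: ler_sum => b ba.
rewrite /dep eq_sym ba /=; case: eqP => [ab0|_] /=.
  have cU : #|Q a :|: Q b| = (#|Q a| + #|Q b|)%N.
    by rewrite cardsU ab0 cards0 subn0.
  by rewrite addr0 cU ffact_ratioD // -cU max_card.
by apply: ler_wpDl; [rewrite mulr_ge0 ?ffact_ratio_ge0 | exact: ratio_le].
Qed.

(* Cantelli's inequality at distance [2 s / 3] with shift [s / 3]; the two-sided
   Chebyshev bound would only give [9 / 16] here. *)
Lemma half_le_of_variance {R : realFieldType} {I : finType} (P : pred I)
    (X : I -> R) (nu V s x : R) :
  \sum_(i | P i) X i = #|P|%:R * nu ->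
  \sum_(i | P i) X i ^+ 2 <= #|P|%:R * (nu ^+ 2 + V) ->
  0 < s -> V <= s ^+ 2 / 4 -> nu + 2 / 3 * s <= x ->
  #|P|%:R / 2 <= #|[pred i | P i && (X i <= x)]|%:R :> R.
Proof.
move=> sumX sumX2 s0 Vs nux.
pose good := [pred i | P i && (X i <= x)].
pose bad := [pred i | P i && ~~ (X i <= x)].
have cardP : #|P|%:R = #|good|%:R + #|bad|%:R :> R.
  rewrite -natrD -(cardID [pred i | X i <= x] P); congr (_ + _)%:R.
  by apply: eq_card => i; rewrite !inE andbC.
have s2 : 0 < s ^+ 2 by rewrite exprn_gt0.
have n0 : 0 <= #|P|%:R :> R by [].
(* Markov's inequality for [(X - nu + s / 3) ^ 2]: it exceeds [s ^ 2] on [bad], where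
   [X - nu > 2 s / 3], and its mean is at most [V + s ^ 2 / 9]. *)
have bad_le : #|bad|%:R * s ^+ 2 <= #|P|%:R * (V + s ^+ 2 / 9).
  apply: (@le_trans _ _ (\sum_(i | P i) (X i - nu + s / 3) ^+ 2)).
    rewrite (bigID (fun i => X i <= x)) /=; apply: ler_wpDl.
      by apply: sumr_ge0 => i _; exact: sqr_ge0.
    rewrite mulr_natl -sumr_const; apply: ler_sum => i /andP[_].
    rewrite -ltNge => xX; rewrite lerXn2r // ?nnegrE; lra.
  rewrite (eq_bigr (fun i => X i ^+ 2 + ((2 * (s / 3 - nu)) * X i
    + (s / 3 - nu) ^+ 2))) => [|i _]; last by ring.
  rewrite !big_split /= -mulr_sumr sumX sumr_const -mulr_natl.
  set n := #|P|%:R in n0 sumX2 *.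
  have := sumX2; nra.
(* Here [1 / 4 + 1 / 9 = 13 / 36 < 1 / 2]. *)
have : #|bad|%:R * s ^+ 2 <= #|P|%:R * (1 / 2) * s ^+ 2.
  apply: le_trans bad_le _; rewrite -mulrA ler_wpM2l //; lra.
rewrite ler_pM2r // cardP -/good; lra.
Qed.

(** The first-order bound [1 - (1 + tau) eps] leaves room [tau eps / 3]. The second-order term
    vanishes for [k = 1]; otherwise it is at most [2 eps ^ 2], which fits since [6 eps <= tau]. *)
Lemma expr_deficit_le {R : realFieldType} (k : nat) (eps tau : R) :
  (0 < k)%N -> 0 < eps -> 0 < tau <= 1 -> (1 < k)%N%:R * (6 * eps) <= tau ->
  (1 + tau) * eps / k%:R <= 1 ->
  (1 - (1 + tau) * eps / k%:R) ^+ k <= 1 - eps - 2 / 3 * (tau * eps).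
Proof.
move=> k0 eps0 /andP[tau0 tau1] keps.
set d := (1 + tau) * eps / k%:R => d1.
have te0 : 0 < tau * eps by rewrite mulr_gt0.
have kR0 : 0 < k%:R :> R by rewrite ltr0n.
have kd : k%:R * d = (1 + tau) * eps by rewrite /d mulrC divfK // gt_eqF.
have d0 : 0 <= d by rewrite divr_ge0 // mulr_ge0 //; lra.
have := expr_onem_le d k; rewrite d0 d1 kd => /(_ isT) /le_trans; apply.
case: ltnP keps => [k1 | k1 _]; last first.
  have -> : k = 1%N by lia.
  by rewrite subrr mulr0 !mul0r; lra.
rewrite mul1r => keps.
have dk : k%:R * (k%:R - 1) / 2 * d ^+ 2 <= 2 * eps ^+ 2.
  apply: (@le_trans _ _ ((k%:R * d) ^+ 2 / 2)).
    have -> : (k%:R * d) ^+ 2 / 2 = k%:R * (k%:R - 1) / 2 * d ^+ 2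
      + k%:R * d ^+ 2 / 2 by field.
    by rewrite lerDl divr_ge0 // mulr_ge0 // sqr_ge0.
  rewrite kd exprMn.
  have : (1 + tau) ^+ 2 <= 4 by rewrite expr2; nra.
  have : 0 <= eps ^+ 2 by exact: sqr_ge0.
  nra.
have : 6 * eps * eps <= tau * eps by rewrite ler_wpM2r // ltW.
rewrite expr2 in dk; lra.
Qed.

Lemma sum_ffact_ratio_le {R : realType} {G T : finType} (Q : T -> {set G})
    (p d : R) (k m : nat) : (forall a, (k <= #|Q a|)%N) ->
  (m <= #|G|)%N -> (0 < #|G|)%N -> 0 <= p -> 0 <= d <= 1 ->
  m%:R / #|G|%:R <= (1 - d) * p ->
  \sum_a ffact_ratio #|G| m #|Q a| <= (1 - d) ^+ k * mean_sub Q (fun=> p).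
Proof.
move=> kQ mN N0 p0 /andP[d0 d1] mp.
rewrite mean_sub_const mulr_sumr; apply: ler_sum => a _.
apply: le_trans (ffact_ratio_le _ _ _ mN (max_card _) N0) _.
apply: (@le_trans _ _ (((1 - d) * p) ^+ #|Q a|)).
  by rewrite lerXn2r // nnegrE ?divr_ge0 // mulr_ge0 // subr_ge0.
rewrite exprMn ler_wpM2r ?exprn_ge0 //.
by rewrite ler_wiXn2l ?subr_ge0 ?gerBl ?kQ.
Qed.

Lemma slice_half_le {R : realType} {G T : finType} (Q : T -> {set G})
    (p : R) (k m : nat) (eps tau : R) :
  (0 < #|T|)%N -> 0 < p -> (0 < k)%N -> (forall a, (k <= #|Q a|)%N) ->
  0 < eps -> 0 < tau <= 1 -> (1 < k)%N%:R * (6 * eps) <= tau ->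
  4 * tau ^- 2 * Lambda Q (fun=> p) <= (eps * mean_sub Q (fun=> p)) ^+ 2 ->
  (m <= #|G|)%N ->
  m%:R <= (1 - (1 + tau) * eps / k%:R) * (#|G|%:R * p) ->
  #|[pred S : {set G} | #|S| == m]|%:R / 2
  <= #|[pred S : {set G} | (#|S| == m)
         && (count_sub Q S <= (1 - eps) * mean_sub Q (fun=> p))]|%:R :> R.
Proof.
move=> T0 p0 k0 kQ eps0 tau01 keps LQ mN mp.
have /andP[tau0 tau1] := tau01.
have /card_gt0P[a0 _] := T0.
have N0 : (0 < #|G|)%N.
  exact: leq_trans k0 (leq_trans (kQ a0) (max_card _)).
have NR0 : 0 < #|G|%:R :> R by rewrite ltr0n.
have mu0 : 0 < mean_sub Q (fun=> p).
  rewrite mean_sub_const (bigD1 a0) //=; apply: ltr_wpDr; last exact: exprn_gt0.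
  by apply: sumr_ge0 => a _; rewrite exprn_ge0 // ltW.
set mu := mean_sub _ _ in mu0 LQ *.
set d := (1 + tau) * eps / k%:R in mp.
have d0 : 0 <= d by rewrite divr_ge0 // mulr_ge0 //; lra.
(* The bound [0 <= m <= (1 - d) N p] with [N p > 0] forces [1 - d >= 0]. *)
have d1 : d <= 1.
  by rewrite -subr_ge0 -(pmulr_lge0 _ (mulr_gt0 NR0 p0)) (le_trans _ mp).
have mNp : m%:R / #|G|%:R <= (1 - d) * p.
  by rewrite ler_pdivrMr // -mulrA [p * _]mulrC.
have cardC : #|[pred S : {set G} | #|S| == m]| = 'C(#|G|, m).
  by rewrite -card_draws cardsE.
pose nu : R := \sum_a ffact_ratio #|G| m #|Q a|.
apply: (half_le_of_variance _ _ nu (Lambda Q (fun=> p)) (tau * eps * mu)).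
- by rewrite cardC sum_slice_count.
- rewrite cardC sum_slice_count_sqr // ler_wpM2l //.
  apply: sum_ffact_ratio_setU_le => //; apply: le_trans mNp _.
  by rewrite ler_piMl ?gerBl // ltW.
- by rewrite !mulr_gt0.
- have t2 : 0 < tau ^+ 2 by rewrite exprn_gt0.
  rewrite ler_pdivlMr // -mulrA exprMn -ler_pdivrMl //.
  by apply: le_trans LQ; rewrite le_eqVlt; apply/orP; left; apply/eqP; ring.
have d01 : 0 <= d <= 1 by rewrite d0.
have := sum_ffact_ratio_le _ _ _ _ _ kQ mN N0 (ltW p0) d01 mNp.
have := expr_deficit_le _ _ _ k0 eps0 tau01 keps d1; rewrite -/d -/mu -/nu.
rewrite -(ler_pM2r mu0) => h1 h2; have := le_trans h2 h1; lra.
Qed.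

(** * Summation over the slices *)

Lemma rset_Pr_slices {R : realType} {G : finType} (p : R) (A : pred {set G}) :
  rset_Pr (fun _ : G => p) A
  = \sum_(m < #|G|.+1) p ^+ m * (1 - p) ^+ (#|G| - m)
      * #|[pred S : {set G} | (#|S| == m) && A S]|%:R.
Proof.
rewrite /rset_Pr.
(* No size exceeds [#|G|], so [inord] never falls back to its default value. *)
rewrite (partition_big (fun S : {set G} => inord #|S| : 'I_#|G|.+1) xpredT) //=.
apply: eq_bigr => m _; rewrite mulr_natr -sumr_const.
have cE (S : {set G}) : (inord #|S| == m :> 'I_#|G|.+1) = (#|S| == m).
  by rewrite -val_eqE /= inordK // ltnS max_card.
apply: eq_big => [S|S /andP[_]]; first by rewrite cE inE andbC.
by rewrite cE rset_mass_const => /eqP->.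
Qed.

Theorem theorem17 (R : realType) (G T : finType) (Q : T -> {set G})
    (hT : (0 < #|T|)%N)
    (p : R) (hp : 0 <= p <= 1)
    (k : nat) (hk : (1 <= k)%N) (hQ : forall a : T, (k <= #|Q a|)%N)
    (eps tau : R) (heps : 0 < eps <= 1) (htau : 0 < tau <= 1)
    (htau_eps : (1 < k)%N%:R * (6 * eps) <= tau)
    (hLambda : 4 * tau ^- 2 * Lambda Q (fun=> p)
               <= (eps * mean_sub Q (fun=> p)) ^+ 2) :
  1 / 2 * rset_Pr (fun _ : G => p)
    (fun S : {set G} => rset_card S
       <= (1 - (1 + tau) * eps / k%:R) * rset_E (fun _ : G => p) rset_card)
  <= rset_Pr (fun _ : G => p)
       (fun S : {set G} => count_sub Q S <= (1 - eps) * mean_sub Q (fun=> p)).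
Proof.
have /andP[p0 p1] := hp; have /andP[eps0 eps1] := heps.
rewrite !rset_Pr_slices mulr_sumr; apply: ler_sum => m _.
rewrite mulrCA ler_wpM2l ?mulr_ge0 ?exprn_ge0 ?subr_ge0 // mul1r mulrC.
rewrite rset_E_card /rset_card.
(* The size event contains a slice entirely or misses it; a missed slice contributes 0 on the
   left. *)
have [mle|mgt] :=
  boolP (m%:R <= (1 - (1 + tau) * eps / k%:R) * (#|G|%:R * p)); last first.
  rewrite eq_card0 ?mul0r // => S; rewrite !inE.
  by apply/negbTE; apply: contra mgt => /andP[/eqP->].
apply: (@le_trans _ _ (#|[pred S : {set G} | #|S| == m]|%:R / 2)).
  rewrite ler_wpM2r ?invr_ge0 // ler_nat subset_leq_card //.
  by apply/subsetP => S; rewrite !inE => /andP[].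
(* For [p = 0] the mean is 0 and Cantelli's inequality has no positive distance to work with. Then
   only [m = 0] passes the threshold, and the empty set contains no [Q a] because [k >= 1]. *)
move: p0; rewrite le_eqVlt => /predU1P[p0|p0]; last first.
  apply: (slice_half_le _ _ k _ _ tau) => //; rewrite -ltnS; exact: ltn_ord.
have m0 : m = 0%N :> nat.
  by move: mle; rewrite -p0 !mulr0 (lern0 R m) => /eqP.
rewrite ler_pdivrMr // -natrM ler_nat; apply: leq_trans (leq_pmulr _ _) => //.
apply/subset_leq_card/subsetP => S; rewrite !inE m0 => /eqP/cards0_eq->.
rewrite cards0 eqxx /= mean_sub_const /count_sub big1 => [|a _]; last first.
  by rewrite /indic subset0 -cards_eq0; have := leq_trans hk (hQ a); case: #|Q a|.
rewrite mulr_ge0 ?subr_ge0 // sumr_ge0 // => a _.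
by rewrite -p0 exprn_ge0.
Qed.
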